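(* Let $G$ be a finite group and let $x\in G$ be a rational non-vanishing element. Then $|C_G(x)|\geq \omega(G)$, where $C_G(x)$ is the centralizer of $x$ in $G$ and $\omega(G)=\left(\sum_{\chi\in \mathrm{Irr}(G)}\chi(1)\right)^2/|G|$.
   Context: For a finite group $G$, $\mathrm{Irr}(G)$ denotes the set of all irreducible complex characters of $G$. An element $x\in G$ is called vanishing if $\chi(x)=0$ for some $\chi\in\mathrm{Irr}(G)$; otherwise $x$ is called non-vanishing. An element $x\in G$ is called rational if $x$ is conjugate in $G$ to $x^i$ for every integer $i$ coprime to the order of $x$. The weight of $G$ is $\omega(G):=\left(\sum_{\chi\in \mathrm{Irr}(G)}\chi(1)\right)^2/|G|$. *)

(* Defs.v *)
From mathcomp Require Import all_boot all_order all_fingroup all_algebra.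
From mathcomp Require Import all_solvable all_field all_character.

Set Implicit Arguments.
Unset Strict Implicit.
Unset Printing Implicit Defensive.

Import GroupScope Order.TTheory GRing.Theory Num.Theory.
Local Open Scope ring_scope.

(* [irr G] lists the irreducible characters over [algC]; every complex
   character of a finite group takes algebraic values, so these are the
   irreducible complex characters. *)

Definition vanishing (gT : finGroupType) (G : {group gT}) (x : gT) : Prop :=
  exists i : Iirr G, 'chi[G]_i x = 0.

Definition zexpg (gT : finGroupType) (x : gT) (i : int) : gT :=
  match i with
  | Posz n => (x ^+ n)%g
  | Negz n => (x ^- n.+1)%g
  end.

Definition rational_elt (gT : finGroupType) (G : {group gT}) (x : gT) : Prop :=
  forall i : int, coprimez i #[x]%g -> zexpg x i \in (x ^: G)%g.

Definition weight (gT : finGroupType) (G : {group gT}) : algC :=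
  (\sum_(i : Iirr G) 'chi[G]_i 1%g) ^+ 2 / #|G|%:R.

(* Main.v *)
(** Let [x] have order [n] and let [z] be a primitive [n]-th root of unity.
    A character value [chi (x ^+ k)] is [p.[z ^+ k]] for a fixed integer
    polynomial [p].  If [x] is rational these values agree for all [k] coprime
    to [n], so the remainder of [p] modulo the monic integer polynomial ['Phi_n]
    is constant and [chi x] is an integer.  If [x] is moreover non-vanishing,
    [|chi x| >= 1] for every irreducible [chi], whence by Cauchy-Schwarz and the
    orthogonality of columns
      [(\sum chi 1)^2 <= (\sum chi 1 |chi x|)^2
                      <= (\sum (chi 1)^2) (\sum |chi x|^2) = |G| |C_G(x)|]. *)

Require Import Defs.
From mathcomp Require Import all_boot all_order all_fingroup all_algebra.
From mathcomp Require Import all_solvable all_field all_character.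
From mathcomp Require Import ring.

Set Implicit Arguments.
Unset Strict Implicit.
Unset Printing Implicit Defensive.

Import GroupScope Order.TTheory GRing.Theory Num.Theory.
Local Open Scope ring_scope.

Lemma sum_CauchySchwarz (F : numFieldType) (I : finType) (a b : I -> F) :
  (forall i, 0 <= a i) -> (forall i, 0 <= b i) ->
  (\sum_i a i * b i) ^+ 2 <= (\sum_i a i ^+ 2) * (\sum_i b i ^+ 2).
Proof.
move=> a_ge0 b_ge0.
set S := \sum_i a i * b i; set A := \sum_i a i ^+ 2; set B := \sum_i b i ^+ 2.
have S_ge0 : 0 <= S by apply: sumr_ge0 => i _; rewrite mulr_ge0.
have : 0 <= B by apply: sumr_ge0 => i _; rewrite exprn_ge0.
rewrite le_eqVlt => /predU1P[B0 | B_gt0].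
  have b0 i : b i = 0.
    apply/eqP; rewrite -sqrf_eq0; apply/eqP; move: i isT.
    by apply/psumr_eq0P => // i _; rewrite exprn_ge0.
  have -> : S = 0 by rewrite /S big1 // => i _; rewrite b0 mulr0.
  by rewrite -B0 mulr0 expr0n.
rewrite -subr_ge0 -(pmulr_rge0 _ B_gt0).
(* The vector [B * a - S * b] is [B] times the component of [a] orthogonal to [b]. *)
have -> : B * (A * B - S ^+ 2) = \sum_i (B * a i - S * b i) ^+ 2.
  transitivity (\sum_i (B ^+ 2 * a i ^+ 2 - (B * S) *+ 2 * (a i * b i)
                        + S ^+ 2 * b i ^+ 2)).
    rewrite big_split sumrB /= -!mulr_sumr -/A -/B -/S.
    ring.
  by apply: eq_bigr => i _; ring.
(* In a [numFieldType] a square can be negative or non-real; the signs of [a] and [b] make the base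
   real. *)
apply: sumr_ge0 => i _; apply: real_exprn_even_ge0 => //.
by rewrite rpredB // ger0_real ?mulr_ge0 // ltW.
Qed.

(** On the abelian group [<[x]>] the character splits into linear ones. Each sends [x] to some
    [z ^+ e], hence [x ^+ k] to [(z ^+ k) ^+ e], and contributes the monomial ['X^e]. *)
Lemma char_cycle_poly (gT : finGroupType) (G : {group gT}) (chi : 'CF(G))
    (x : gT) (z : algC) :
  chi \is a character -> x \in G -> #[x]%g.-primitive_root z ->
  exists p : {poly int}, forall k, chi (x ^+ k)%g = (map_poly intr p).[z ^+ k].
Proof.
move=> Nchi Gx prim_z; have sxG : <[x]> \subset G by rewrite cycle_subG.
have [r Dchi] := char_sum_irr (cfRes_char <[x]> Nchi).
have lin_x (i : Iirr <[x]>) : 'chi_i \is a linear_char.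
  by apply/char_abelianP/cycle_abelian.
have z_log i : {e : 'I_#[x] | 'chi[<[x]>]_i x = z ^+ e}.
  by apply: prim_rootP prim_z _ _; rewrite -lin_charX ?cycle_id // expg_order lin_char1.
exists (\sum_(i <- r) 'X^(sval (z_log i))) => k.
rewrite -(cfResE chi sxG (mem_cycle x k)) Dchi sum_cfunE rmorph_sum horner_sum.
apply: eq_bigr => i _; rewrite lin_charX ?cycle_id //.
by case: (z_log i) => e /= ->; rewrite map_polyXn hornerXn exprAC.
Qed.

Lemma int_num_horner_prim_root (n : nat) (z a : algC) (p : {poly int}) :
  n.-primitive_root z ->
  (forall k, coprime k n -> (map_poly intr p).[z ^+ k] = a) -> a \in Num.int.
Proof.
move=> prim_z pa; have n_gt0 := prim_order_gt0 prim_z.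
pose r := Pdiv.Ring.rmodp p 'Phi_n.
have ra k : coprime k n -> (map_poly intr r).[z ^+ k] = a.
  move=> co_kn; rewrite -(pa k co_kn).
  rewrite [in RHS](Pdiv.RingMonic.rdivp_eq (Cyclotomic_monic n) p).
  rewrite rmorphD rmorphM /= hornerD hornerM (Cintr_Cyclotomic prim_z).
  suff /rootP-> : root (cyclotomic z n) (z ^+ k) by rewrite mulr0 add0r.
  by rewrite root_cyclotomic // prim_root_exp_coprime.
(* [r - a] has degree below [totient n]; for the constant [a] this uses [0 < totient n]. *)
have sz_r : (size (map_poly intr r - a%:P : {poly algC})%R
             < size (cyclotomic z n))%N.
  rewrite size_cyclotomic ltnS (leq_trans (size_polyD _ _)) // geq_max.
  rewrite size_polyN (leq_trans (size_polyC_leq1 _)) ?totient_gt0 // andbT.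
  rewrite (leq_trans (size_poly _ _)) // -ltnS -size_Cyclotomic.
  by rewrite Pdiv.Ring.ltn_rmodpN0 ?monic_neq0 ?Cyclotomic_monic.
(* The [totient n] primitive roots [z ^+ k] are distinct roots of [r - a], which is therefore zero:
   [a] is the constant coefficient of [r]. *)
have dvd_r : cyclotomic z n %| map_poly intr r - a%:P.
  rewrite /cyclotomic -big_filter.
  rewrite -(big_map (fun k : 'I_n => z ^+ k) xpredT (fun c => 'X - c%:P)).
  apply: uniq_roots_dvdp.
    apply/allP => c /mapP[k]; rewrite mem_filter => /andP[co_kn _] ->.
    by apply/rootP; rewrite hornerD hornerN hornerC ra ?subrr.
  rewrite uniq_rootsE map_inj_uniq ?filter_uniq ?index_enum_uniq // => i j /eqP.
  by rewrite (eq_prim_root_expr prim_z) !modn_small // => /eqP/val_inj.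
have /eqP : map_poly intr r - a%:P == 0 :> {poly algC}.
  by apply: contraTT dvd_r => nz_r; rewrite gtNdvdp.
move/(congr1 (coefp 0)); rewrite /= coefB coefC coef_map coef0 => /subr0_eq <-.
exact: intr_int.
Qed.

Lemma rational_elt_char_int (gT : finGroupType) (G : {group gT})
    (chi : 'CF(G)) (x : gT) :
  chi \is a character -> x \in G -> rational_elt G x -> chi x \in Num.int.
Proof.
move=> Nchi Gx ratx; have [z prim_z] := C_prim_root_exists (order_gt0 x).
have [p Dp] := char_cycle_poly Nchi Gx prim_z.
apply: (int_num_horner_prim_root prim_z (p := p)) => k co_kx; rewrite -Dp.
by have /imsetP[y Gy /= ->] := ratx k%:Z co_kx; rewrite cfunJ.
Qed.

Theorem theorem1p1 (gT : finGroupType) (G : {group gT}) (x : gT)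
    (xG : x \in G) (xrat : rational_elt G x) (xnv : ~ vanishing G x) :
  weight G <= #|'C_G[x]%g|%:R.
Proof.
have chi_x_ge1 i : 1 <= `|'chi[G]_i x|.
  apply: norm_intr_ge1; first by rewrite rational_elt_char_int ?irr_char.
  by apply/eqP => chi_x0; apply: xnv; exists i.
rewrite /weight ler_pdivrMr ?ltr0n ?cardG_gt0 // mulrC.
have := second_orthogonality_relation x xG; rewrite class_refl mulr1n => <-.
(* Column orthogonality at the identity, whose centralizer is [G], turns [#|G|] into the sum of the
   squared degrees. *)
have := second_orthogonality_relation 1%g (group1 G).
rewrite cent11T setIT class_refl mulr1n => <-.
under [X in _ <= X * _]eq_bigr => i _ do
  rewrite -normCK ger0_norm ?(ltW (irr1_gt0 i)) //.
under [X in _ <= _ * X]eq_bigr => i _ do rewrite -normCK.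
have chi1_ge0 (i : Iirr G) : 0 <= 'chi_i 1%g := ltW (irr1_gt0 i).
apply: le_trans (sum_CauchySchwarz chi1_ge0 (fun i => normr_ge0 ('chi_i x))).
rewrite lerXn2r ?nnegrE ?sumr_ge0 // => [i _|]; first by rewrite mulr_ge0.
by apply: ler_sum => i _; rewrite ler_peMr.
Qed.
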